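(* Let $n\ge2$, let $f=(f_1,\dots,f_n)$ be a polynomial system on $\mathbb{C}^n$, let $\xi$ be a simple double zero of $f$ such that $Df(\xi)$ has the normalized form, let $z\in\mathbb{C}^n$, $z\ne\xi$, be an approximate zero, and put $u=\gamma_2(f,\xi)^2\|z-\xi\|$. Let $N_f$ be the modified Newton iteration for simple double zeros and $b_{2,1},b_{2,3}$ the rational functions defined in the context. (1) If $u<u_2\approx0.0418$, where $u_2$ is the smallest positive solution of the equation $2b_{2,1}(u)^2+2b_{2,3}(u)^2=1$, then $$\|N_f(z)-\xi\|<\|z-\xi\|.$$ (2) If $u<u_2'\approx0.0318$, where $u_2'$ is the smallest positive solution of the equation $2b_{2,1}(u)^2+2b_{2,3}(u)^2=\frac14$, then after $k\ge1$ iterations $$\|N_f^k(z)-\xi\|<\left(\tfrac12\right)^{2^k-1}\|z-\xi\|.$$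
   Context: Notation. $X=(X_1,\hat X)$, $\hat X=(X_2,\dots,X_n)$, $\hat f=(f_1,\dots,f_{n-1})$; $D\hat f$ is the $(n-1)\times(n-1)$ Jacobian of $\hat f$ with respect to $\hat X$; for $k\ge2$, $D^k\hat f$ and $D^kf_n$ are the $k$-th derivatives with respect to all variables $X_1,\dots,X_n$. $\|\cdot\|$ is the Hermitian norm on vectors and the operator norm on matrices and multilinear maps. Simple double zero with normalized Jacobian: $f(\xi)=0$, $D\hat f(\xi)$ is invertible, $\frac{\partial f_i(\xi)}{\partial X_1}=0$ and $\frac{\partial f_n(\xi)}{\partial X_i}=0$ for $1\le i\le n$, and $\Delta_2(f_n)=\frac12\frac{\partial^2f_n(\xi)}{\partial X_1^2}\ne0$. $$\gamma_2(f,\xi)=\max\Big(1,\ \sup_{k\ge2}\Big\|D\hat f(\xi)^{-1}\tfrac{D^k\hat f(\xi)}{k!}\Big\|^{\frac1{k-1}},\ \sup_{k\ge2}\Big\|\tfrac{1}{\Delta_2(f_n)}\tfrac{D^kf_n(\xi)}{k!}\Big\|^{\frac1{k-1}}\Big).$$ Modified Newton iteration for simple double zeros: for $z=(z_1,\hat z)$ put $N_1(\hat z)=\hat z-D\hat f(z)^{-1}\hat f(z)$, $\hat y=N_1(\hat z)$, and $$N_2(z_1)=z_1-\Big(\frac{\partial^2f_n}{\partial X_1^2}(z_1,\hat y)\Big)^{-1}\frac{\partial f_n}{\partial X_1}(z_1,\hat y),\qquad N_f(z)=(N_2(z_1),N_1(\hat z)).$$ $N_f^k$ is its $k$-fold iterate.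 Rational functions: $$b_{2,1}(u)=\frac{(1-2u)^2u}{[2(1-2u)^2-1](1-u)},$$ $$b_{2,3}(u)=\frac{u(32u^6-144u^5+272u^4-288u^3+174u^2-52u+5)}{(24u^3-36u^2+18u-1)(-1+u)^3(8u^2-8u+1)}.$$ *)

(* Defs.v *)
From mathcomp Require Import all_boot all_order all_algebra.
From mathcomp Require Import complex.
From mathcomp Require Import mpoly.
From mathcomp Require Import classical_sets reals exp.

Set Implicit Arguments.
Unset Strict Implicit.
Unset Printing Implicit Defensive.

Import Order.TTheory GRing.Theory Num.Theory.
Local Open Scope classical_set_scope.
Local Open Scope ring_scope.

(* The dimension is n = m.+1, so that m = n - 1 is the size of the hatted
   objects.  Variables are split as X_1 = ord0 and the others = lift ord0 j;
   equations are split as f_n = ord_max and the others = lift ord_max i. *)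
Definition polysystem (R : realType) (m : nat) : Type :=
  'I_m.+1 -> {mpoly R[i][m.+1]}.

Section Defs.
Variable R : realType.
Local Notation C := R[i].
Local Notation normc := ComplexField.Normc.normc.

(* Not the sup norm that MathComp-Analysis puts on matrices. *)
Definition hnorm (n : nat) (x : 'cV[C]_n) : R :=
  Num.sqrt (\sum_(i < n) normc (x i 0) ^+ 2).

(* Operator norm of a k-linear map A, for the Hermitian norm on its arguments
   and the norm N on its values. *)
Definition multinorm (n k : nat) (W : Type) (N : W -> R)
    (A : k.-tuple 'cV[C]_n -> W) : R :=
  sup [set N (A v) | v in
        [set v : k.-tuple 'cV[C]_n | forall l : 'I_k, hnorm (tnth v l) = 1]].

Section Derivatives.
Variable n : nat.
Implicit Types (p : {mpoly C[n]}) (x v : 'cV[C]_n).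

Definition evalp p x : C := p.@[fun i => x i 0].

Definition dirderiv v p : {mpoly C[n]} := \sum_(i < n) v i 0 *: p^`M(i).

(* D^k p(x)(v_1, ..., v_k) *)
Definition Dk (k : nat) p x (v : k.-tuple 'cV[C]_n) : C :=
  evalp (foldr dirderiv p v) x.

End Derivatives.

Section System.
Variables (m : nat) (f : polysystem R m).
Implicit Types x z : 'cV[C]_m.+1.

Definition fhat (i : 'I_m) : {mpoly C[m.+1]} := f (lift ord_max i).
Definition flast : {mpoly C[m.+1]} := f ord_max.

Definition hatv z : 'cV[C]_m := \col_(j < m) z (lift ord0 j) 0.

(* The point (a, y) of C x C^m. *)
Definition joinv (a : C) (y : 'cV[C]_m) : 'cV[C]_m.+1 :=
  \col_i (if unlift ord0 i is Some j then y j 0 else a).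

Definition fhat_at x : 'cV[C]_m := \col_(i < m) evalp (fhat i) x.

Definition Dfhat x : 'M[C]_m :=
  \matrix_(i < m, j < m) evalp (fhat i)^`M(lift ord0 j) x.

Definition Dkfhat (k : nat) x (v : k.-tuple 'cV[C]_m.+1) : 'cV[C]_m :=
  \col_(i < m) Dk (fhat i) x v.

Definition dflast x : C := evalp flast^`M(ord0) x.
Definition d2flast x : C := evalp (flast^`M(ord0))^`M(ord0) x.

Definition Delta2 x : C := 2^-1 * d2flast x.

Definition simple_double_zero_normalized x : Prop :=
  [/\ forall i, evalp (f i) x = 0,
      Dfhat x \in unitmx,
      forall i, evalp (f i)^`M(ord0) x = 0,
      forall i, evalp flast^`M(i) x = 0
    & Delta2 x != 0].

Definition gamma2_hat x (k : nat) : R :=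
  multinorm (@hnorm m)
    (fun v : k.-tuple 'cV[C]_m.+1 =>
       invmx (Dfhat x) *m ((k`!)%:R^-1 *: Dkfhat x v)) `^ (k.-1%:R)^-1.

Definition gamma2_last x (k : nat) : R :=
  multinorm (@ComplexField.Normc.normc R)
    (fun v : k.-tuple 'cV[C]_m.+1 =>
       (Delta2 x)^-1 * (Dk flast x v / (k`!)%:R)) `^ (k.-1%:R)^-1.

(* Both suprema are over sets that are bounded, f being polynomial. *)
Definition gamma2 x : R :=
  Num.max 1
    (Num.max (sup [set gamma2_hat x k | k in [set k : nat | (2 <= k)%N]])
             (sup [set gamma2_last x k | k in [set k : nat | (2 <= k)%N]])).

(* N_1 maps hat z to hat z - D fhat(z)^-1 fhat(z): it also depends on z_1. *)
Definition newton1 z : 'cV[C]_m := hatv z - invmx (Dfhat z) *m fhat_at z.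

Definition newton2 z : C :=
  let y := joinv (z ord0 0) (newton1 z) in
  z ord0 0 - (d2flast y)^-1 * dflast y.

Definition newton z : 'cV[C]_m.+1 := joinv (newton2 z) (newton1 z).

(* invmx and ^-1 are total; this says that both inverses in the definition of
   newton z are genuine. *)
Definition newton_defined z : Prop :=
  Dfhat z \in unitmx /\ d2flast (joinv (z ord0 0) (newton1 z)) != 0.

End System.

(* Division by zero yields 0; the positive poles of b21 and b23 are all greater
   than 0.06. *)
Definition b21 (u : R) : R :=
  ((1 - 2 * u) ^+ 2 * u) / ((2 * (1 - 2 * u) ^+ 2 - 1) * (1 - u)).

Definition b23 (u : R) : R :=
  (u * (32 * u ^+ 6 - 144 * u ^+ 5 + 272 * u ^+ 4 - 288 * u ^+ 3
        + 174 * u ^+ 2 - 52 * u + 5))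
  / ((24 * u ^+ 3 - 36 * u ^+ 2 + 18 * u - 1) * (-1 + u) ^+ 3
     * (8 * u ^+ 2 - 8 * u + 1)).

Definition smallest_positive (P : R -> Prop) (u : R) : Prop :=
  [/\ 0 < u, P u & forall v, 0 < v -> P v -> u <= v].

(* x agrees with the decimal d to four decimal places (rounding). *)
Definition approx4 (x d : R) : Prop := `|x - d| <= 2^-1 * 10 ^- 4.

End Defs.

(* Main.v *)
From HB Require Import structures.
Require Import Defs.
From mathcomp Require Import all_boot all_order all_algebra.
From mathcomp Require Import complex.
From mathcomp Require Import reals.
From mathcomp Require Import mpoly classical_sets exp.
From mathcomp Require Import ring lra zify.

Set Implicit Arguments.
Unset Strict Implicit.
Unset Printing Implicit Defensive.

Import Order.TTheory GRing.Theory Num.Theory.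
Local Open Scope complex_scope.
Local Open Scope ring_scope.

(** Write g = gamma_2(f, xi), w = z - xi, r = ||w||, u = g^2 r.  The theorem
follows from one quadratic estimate: if u <= 0.042, the iteration is defined
at z and

  ||N_f(z) - xi|| <= 7 u r = 7 g^2 r^2          (lemma newton_contraction).

The two roots, about 0.0418 and 0.0318, are below 0.042, and 7 u is less than 1
below the first and less than 1/2 below the second.  Since the estimate is
quadratic, the relative errors q_k = ||N_f^k(z) - xi|| / r satisfy
q_(k+1) <= 7 u q_k^2, which gives (1/2)^(2^k - 1).

As for the roots, b_{2,1} and b_{2,3} are quotients of a growing numerator by a
shrinking positive denominator on [0, 0.042], hence a root found there by the
intermediate value theorem is the smallest positive one.

The estimate is a term-by-term comparison of finite Taylor expansions at xi.
By definition of g, the k-th Taylor form of D fhat(xi)^-1 fhat, or of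
f_n / Delta_2, is bounded on vectors v_1, ..., v_k by g^(k-1) ||v_1|| ... ||v_k||
(lemmas hat_bound and last_bound).

Hatted coordinates.  D fhat(xi)^-1 D fhat(z) differs from the identity by an
operator of norm at most sum_(k >= 1) (k+1) (g r)^k < 1, so D fhat(z) is
invertible.  The error e of the half step N_1 satisfies, because the first
derivatives of fhat along X_1 vanish at xi,

  D fhat(z) e = sum_(k >= 1) 1/(k+1)! D^(k+1) fhat(xi) (w, ..., w, (-w_1, k what))

and the last vector has norm at most k r.  Hence ||e|| <= 5/4 g r^2.

First coordinate.  Let v = (w_1, e) be the error after the half step and e_1
the first basis vector.  Then N_2(z_1) - xi_1 is the quotient of
d^2 f_n w_1 - d f_n by d^2 f_n, both derivatives being taken along X_1 at xi + v.
Divided by Delta_2, the denominator is within 3/10 of 2, while the numerator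
becomes

  1/Delta_2 sum_(k >= 0) 1/(k+1)! D^(k+2) f_n(xi) (v, ..., v, (k w_1, -e), e_1).

For k = 0 only e enters, and the bound is 2 g ||e|| <= 5/2 g^2 r^2: this is
where the square of g comes from.  The other terms are controlled by powers of
g^2 ||v||, as g^(k+1) <= g^(2 k) for k >= 1. *)

(** * The Hermitian norm *)

Section HermitianNorm.
Context {R : realType}.
Local Notation C := R[i].
Local Notation normc := ComplexField.Normc.normc.
Implicit Types c : C.

Lemma normc_real c : (normc c)%:C = `|c|.
Proof. by case: c => a b; rewrite normc_def. Qed.

Lemma normc_ge0 c : 0 <= normc c.
Proof. by case: c => a b; exact: sqrtr_ge0. Qed.

Lemma normcD c c' : normc (c + c') <= normc c + normc c'.
Proof. by rewrite -lecR rmorphD /= !normc_real ler_normD. Qed.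

Lemma normcN c : normc (- c) = normc c.
Proof. by apply: (@complexI R); rewrite !normc_real normrN. Qed.

Lemma normc_realC (a : R) : normc a%:C = `|a|.
Proof. by rewrite /= expr0n addr0 sqrtr_sqr. Qed.

Lemma normc_nat (k : nat) : normc (k%:R : C) = k%:R.
Proof.
by rewrite (_ : (k%:R : C) = (k%:R)%:C) ?normc_realC ?normr_nat // rmorph_nat.
Qed.

Lemma normc_sum (I : Type) (r : seq I) (F : I -> C) :
  normc (\sum_(i <- r) F i) <= \sum_(i <- r) normc (F i).
Proof.
elim: r => [|i r IH]; first by rewrite !big_nil ComplexField.Normc.normc0.
by rewrite !big_cons (le_trans (normcD _ _)) // lerD2l.
Qed.

Lemma normc_eq0 c : (normc c == 0) = (c == 0).
Proof.
apply/eqP/eqP => [/ComplexField.Normc.eq0_normc //|->].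
exact: ComplexField.Normc.normc0.
Qed.

Variable n : nat.
Implicit Types x y : 'cV[C]_n.

Lemma hnorm_ge0 x : 0 <= hnorm x. Proof. exact: sqrtr_ge0. Qed.

Lemma hnorm_sqr x : hnorm x ^+ 2 = \sum_(i < n) normc (x i 0) ^+ 2.
Proof. by rewrite sqr_sqrtr // sumr_ge0 // => i _; rewrite sqr_ge0. Qed.

Lemma hnorm_le_coord x y :
  (forall i, normc (x i 0) <= normc (y i 0)) -> hnorm x <= hnorm y.
Proof.
move=> h; rewrite ler_wsqrtr // ler_sum // => i _.
by rewrite lerXn2r ?nnegrE ?normc_ge0.
Qed.

Lemma hnormZ c x : hnorm (c *: x) = normc c * hnorm x.
Proof.
rewrite /hnorm -[X in X * _](ger0_norm (normc_ge0 c)) -sqrtr_sqr -sqrtrM ?sqr_ge0 //.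
congr Num.sqrt; rewrite mulr_sumr; apply: eq_bigr => i _.
by rewrite mxE ComplexField.Normc.normcM exprMn.
Qed.

Lemma hnorm0 : hnorm (0 : 'cV[C]_n) = 0.
Proof. by rewrite -(scale0r 0) hnormZ ComplexField.Normc.normc0 mul0r. Qed.

Lemma hnormN x : hnorm (- x) = hnorm x.
Proof.
by rewrite -scaleN1r hnormZ normcN ComplexField.Normc.normc1 mul1r.
Qed.

Lemma hnorm_eq0 x : (hnorm x == 0) = (x == 0).
Proof.
apply/idP/eqP => [|->]; last by rewrite hnorm0.
rewrite sqrtr_eq0 => le0.
have s0 : \sum_(i < n) normc (x i 0) ^+ 2 == 0.
  by rewrite eq_le le0 sumr_ge0 // => i _; rewrite sqr_ge0.
apply/matrixP => i j; rewrite ord1 mxE; apply/eqP.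
rewrite psumr_eq0 in s0; last by move=> k _; rewrite sqr_ge0.
by move/allP: s0 => /(_ i (mem_index_enum i)); rewrite expf_eq0 normc_eq0.
Qed.

Lemma normc_le_hnorm x i : normc (x i 0) <= hnorm x.
Proof.
rewrite -[leLHS](ger0_norm (normc_ge0 _)) -sqrtr_sqr ler_wsqrtr //.
rewrite (bigD1 i) //= lerDl sumr_ge0 // => j _; exact: sqr_ge0.
Qed.

Lemma hnorm_le_sum x : hnorm x <= \sum_(i < n) normc (x i 0).
Proof.
have s0 : 0 <= \sum_(i < n) normc (x i 0).
  by rewrite sumr_ge0 // => i _; exact: normc_ge0.
rewrite -(@ler_pXn2r _ 2) ?nnegrE ?hnorm_ge0 // hnorm_sqr expr2 mulr_suml.
rewrite ler_sum // => i _; rewrite expr2 ler_wpM2l ?normc_ge0 //.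
by rewrite (bigD1 i) //= lerDl sumr_ge0 // => j _; exact: normc_ge0.
Qed.

Lemma cauchy_schwarz (a b : 'I_n -> R) (A B : R) : 0 <= A -> 0 <= B ->
  \sum_i a i ^+ 2 = A ^+ 2 -> \sum_i b i ^+ 2 = B ^+ 2 ->
  \sum_i a i * b i <= A * B.
Proof.
move=> A0 B0 hA hB.
(* Sum of the inequalities 2 A B a_i b_i <= B^2 a_i^2 + A^2 b_i^2. *)
have key : 2 * (A * B) * \sum_i a i * b i <= 2 * (A * B) * (A * B).
  rewrite mulr_sumr.
  have -> : 2 * (A * B) * (A * B) =
     \sum_i (B ^+ 2 * a i ^+ 2 + A ^+ 2 * b i ^+ 2).
    by rewrite big_split /= -!mulr_sumr hA hB; ring.
  apply: ler_sum => i _; have := sqr_ge0 (B * a i - A * b i); nra.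
have [AB0|] := ltP 0 (A * B); first by rewrite -(@ler_pM2l _ (2 * (A * B))); lra.
move=> AB0; have /eqP : A * B = 0 by apply/eqP; rewrite eq_le AB0 mulr_ge0.
rewrite mulf_eq0 => /orP[] /eqP Z; rewrite Z ?mul0r ?mulr0.
  rewrite big1 // => i _; suff /eqP : a i ^+ 2 == 0.
    by move/eqP; rewrite expf_eq0 /= => /eqP ->; rewrite mul0r.
  move: hA; rewrite Z expr0n /= => /eqP.
  rewrite psumr_eq0; last by move=> k _; rewrite sqr_ge0.
  by move/allP => /(_ i (mem_index_enum i)).
rewrite big1 // => i _; suff /eqP : b i ^+ 2 == 0.
  by move/eqP; rewrite expf_eq0 /= => /eqP ->; rewrite mulr0.
move: hB; rewrite Z expr0n /= => /eqP.
rewrite psumr_eq0; last by move=> k _; rewrite sqr_ge0.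
by move/allP => /(_ i (mem_index_enum i)).
Qed.

Lemma ler_hnormD x y : hnorm (x + y) <= hnorm x + hnorm y.
Proof.
rewrite -(@ler_pXn2r _ 2) ?nnegrE ?addr_ge0 ?hnorm_ge0 //.
have CS := cauchy_schwarz (hnorm_ge0 x) (hnorm_ge0 y)
  (esym (hnorm_sqr x)) (esym (hnorm_sqr y)).
rewrite sqrrD !hnorm_sqr.
apply: (@le_trans _ _ (\sum_i (normc (x i 0) + normc (y i 0)) ^+ 2)).
  apply: ler_sum => i _; rewrite mxE lerXn2r ?nnegrE ?addr_ge0 ?normc_ge0 //.
  exact: normcD.
rewrite (eq_bigr (fun i => normc (x i 0) ^+ 2 + normc (y i 0) ^+ 2
  + 2 * (normc (x i 0) * normc (y i 0)))); last by move=> i _; ring.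
rewrite !big_split /= -mulr_sumr; lra.
Qed.

Lemma hnorm_sum (I : Type) (r : seq I) (F : I -> 'cV[C]_n) :
  hnorm (\sum_(i <- r) F i) <= \sum_(i <- r) hnorm (F i).
Proof.
elim: r => [|i r IH]; first by rewrite !big_nil hnorm0.
by rewrite !big_cons (le_trans (ler_hnormD _ _)) // lerD2l.
Qed.

End HermitianNorm.

(** * Splitting off the first coordinate *)

Section Joinv.
Context {R : realType} {m : nat}.
Local Notation C := R[i].
Local Notation normc := ComplexField.Normc.normc.
Implicit Types (a : C) (y : 'cV[C]_m) (x : 'cV[C]_m.+1).

Lemma joinv0 a y : joinv a y ord0 0 = a.
Proof. by rewrite mxE unlift_none. Qed.

Lemma joinv_lift a y j : joinv a y (lift ord0 j) 0 = y j 0.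
Proof. by rewrite mxE liftK. Qed.

Lemma joinv_hatv x : joinv (x ord0 0) (hatv x) = x.
Proof.
apply/matrixP => i j; rewrite ord1 mxE.
by case: unliftP => [k|] -> //; rewrite mxE.
Qed.

Lemma hnorm_joinv_sqr a y : hnorm (joinv a y) ^+ 2 = normc a ^+ 2 + hnorm y ^+ 2.
Proof.
rewrite !hnorm_sqr big_ord_recl joinv0; congr (_ + _).
by apply: eq_bigr => i _; rewrite joinv_lift.
Qed.

Lemma hnorm_joinv_le a y : hnorm (joinv a y) <= normc a + hnorm y.
Proof.
rewrite -(@ler_pXn2r _ 2) ?nnegrE ?addr_ge0 ?hnorm_ge0 ?normc_ge0 //.
rewrite hnorm_joinv_sqr sqrrD; have := normc_ge0 a; have := hnorm_ge0 y; nra.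
Qed.

Lemma joinv_add a a' y y' : joinv a y + joinv a' y' = joinv (a + a') (y + y').
Proof.
by apply/matrixP => i j; rewrite !mxE; case: unliftP => [k|] _ //; rewrite mxE.
Qed.

Lemma joinv_scale c a y : c *: joinv a y = joinv (c * a) (c *: y).
Proof.
by apply/matrixP => i j; rewrite !mxE; case: unliftP => [k|] _ //; rewrite mxE.
Qed.

End Joinv.

(** * Iterated directional derivatives and Taylor expansion *)

Section Taylor.
Context {R : realType} {n : nat}.
Local Notation C := R[i].
Local Notation normc := ComplexField.Normc.normc.
Implicit Types (p q : {mpoly C[n]}) (x v w : 'cV[C]_n) (s : seq 'cV[C]_n).

Fact dirderiv_is_linear v : linear (dirderiv v).
Proof.
move=> c p q; rewrite /dirderiv scaler_sumr -big_split /=.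
by apply: eq_bigr => i _; rewrite linearP /= scalerDr !scalerA mulrC.
Qed.

HB.instance Definition _ v :=
  GRing.isLinear.Build C {mpoly C[n]} {mpoly C[n]} _ (dirderiv v)
    (dirderiv_is_linear v).

Lemma dirderivDl v w p : dirderiv (v + w) p = dirderiv v p + dirderiv w p.
Proof.
rewrite /dirderiv -big_split; apply: eq_bigr => i _.
by rewrite mxE scalerDl.
Qed.

Lemma dirderivZl c v p : dirderiv (c *: v) p = c *: dirderiv v p.
Proof.
by rewrite /dirderiv scaler_sumr; apply: eq_bigr => i _; rewrite mxE scalerA.
Qed.

Lemma dirderivM v p q :
  dirderiv v (p * q) = dirderiv v p * q + p * dirderiv v q.
Proof.
rewrite /dirderiv mulr_suml mulr_sumr -big_split; apply: eq_bigr => i _.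
by rewrite mderivM scalerDr scalerAl -scalerAr.
Qed.

(** D^k p (v_1, ..., v_k) as a polynomial; stated on sequences rather than
tuples, so that Taylor terms can be built by concatenation. *)
Definition derivs s p : {mpoly C[n]} := foldr (@dirderiv R n) p s.

Fact derivs_is_linear s : linear (derivs s).
Proof. by move=> c p q; elim: s => //= v s ->; rewrite linearP. Qed.

HB.instance Definition _ s :=
  GRing.isLinear.Build C {mpoly C[n]} {mpoly C[n]} _ (derivs s)
    (derivs_is_linear s).

Lemma evalpZ c p x : evalp (c *: p) x = c * evalp p x.
Proof. exact: mevalZ. Qed.

Lemma evalpD p q x : evalp (p + q) x = evalp p x + evalp q x.
Proof. exact: mevalD. Qed.

Lemma evalpN p x : evalp (- p) x = - evalp p x.
Proof. exact: mevalN. Qed.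

Lemma evalp_sum (I : Type) (r : seq I) (F : I -> {mpoly C[n]}) x :
  evalp (\sum_(i <- r) F i) x = \sum_(i <- r) evalp (F i) x.
Proof. exact: raddf_sum. Qed.

Lemma msize_dirderiv v p : (msize (dirderiv v p) <= (msize p).-1)%N.
Proof.
rewrite /dirderiv (leq_trans (msize_sum _ _ _)) //; apply/bigmax_leqP => i _.
rewrite (leq_trans (msizeZ_le _ _)) // msizeE.
apply/bigmax_leqP_seq => mm + _; rewrite mcoeff_msupp mcoeff_mderiv => h.
have : (mm + U_(i))%MM \in msupp p.
  by rewrite mcoeff_msupp; apply: contraNneq h => ->; rewrite mul0rn.
by move/msize_mdeg_lt; rewrite mdegD mdeg1 addn1; case: (msize p).
Qed.

Lemma msize_derivs s p :
  (msize (derivs s p) <= msize p - size s)%N.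
Proof.
elim: s => [|v s IH]; first by rewrite subn0.
rewrite /= (leq_trans (msize_dirderiv _ _)) // subnS.
by rewrite -!subn1 leq_sub2r.
Qed.

Lemma derivs_eq0 s p : (msize p <= size s)%N -> derivs s p = 0.
Proof.
move=> h; apply/eqP; rewrite -msize_poly_eq0 -leqn0.
by rewrite (leq_trans (msize_derivs _ _)) // leqn0 subn_eq0.
Qed.

(** The one-variable polynomial t |-> p (x + t w). *)
Definition restrict_line x w p : {poly C} :=
  mmap polyC (fun i => (x i 0)%:P + (w i 0)%:P * 'X) p.

Lemma horner_restrict_line x w p t :
  (restrict_line x w p).[t] = evalp p (x + t *: w).
Proof.
rewrite /restrict_line /evalp /meval !(mmapE (msize p)) //.
rewrite horner_sum; apply: eq_bigr => k _.
rewrite hornerM hornerC /mmap1 horner_prod; congr (_ * _).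
apply: eq_bigr => i _; rewrite horner_exp !hornerE !mxE.
by rewrite [t * _]mulrC.
Qed.

(** Chain rule along a line: both sides are derivations over the morphism
restrict_line, so they agree once they agree on constants and variables. *)
Lemma deriv_restrict_line x w p :
  (restrict_line x w p)^`() = restrict_line x w (dirderiv w p).
Proof.
pose L := restrict_line x w; rewrite -/L -/(L _).
have LM q q' : L (q * q') = L q * L q' by rewrite /L /restrict_line rmorphM.
have LD q q' : L (q + q') = L q + L q' by rewrite /L /restrict_line raddfD.
have LC c q : L (c *: q) = c%:P * L q by rewrite /L /restrict_line mmapZ.
have LX i : (L 'X_i)^`() = L (dirderiv w 'X_i).
  rewrite {1}/L /restrict_line mmapX mmap1U derivD derivC add0r.
  rewrite derivM derivC mul0r add0r derivX mulr1.
  rewrite /dirderiv (bigD1 i) //= big1 ?addr0 => [|j ji].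
    rewrite mderivX mnm1E eqxx scale1r -[X in (X - _)%MM]add0m addmK mpolyX0 LC.
    by rewrite /L /restrict_line rmorph1 mulr1.
  by rewrite mderivX mnm1E eq_sym (negbTE ji) scale0r scaler0.
have L1 : (L 1)^`() = L (dirderiv w 1).
  rewrite {1}/L /restrict_line rmorph1 /dirderiv big1 => [|i _].
    by rewrite /L /restrict_line raddf0 -polyC1 derivC.
  by rewrite -mpolyC1 mderivC scaler0.
have L0 : (L 0)^`() = L (dirderiv w 0).
  by rewrite linear0 /L /restrict_line raddf0 deriv0.
(* Only the listed properties of L are used from here on. *)
move: L LM LD LC LX L1 L0 => L LM LD LC LX L1 L0.
have Lmul q q' : (L q)^`() = L (dirderiv w q) ->
    (L q')^`() = L (dirderiv w q') ->
    (L (q * q'))^`() = L (dirderiv w (q * q')).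
  by move=> h h'; rewrite LM derivM h h' dirderivM LD !LM.
have Lmon mm : (L 'X_[mm])^`() = L (dirderiv w 'X_[mm]).
  rewrite mpolyXE_id; pose Q q := (L q)^`() = L (dirderiv w q).
  apply: (@big_ind _ Q 1 _ L1 Lmul) => i _.
  elim: (mm i) => [|k IH]; first by rewrite expr0; exact: L1.
  by rewrite exprS; apply: Lmul; [exact: LX | exact: IH].
elim/mpolyind: p => [|c mm p _ _ IH]; first exact: L0.
by rewrite linearD linearZ !LD !LC derivD IH derivM derivC mul0r add0r Lmon.
Qed.

Lemma derivn_restrict_line x w p k :
  (restrict_line x w p)^`(k) = restrict_line x w (derivs (nseq k w) p).
Proof. by elim: k => // k IH; rewrite derivnS IH deriv_restrict_line. Qed.

Lemma coef_restrict_line x w p k :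
  (restrict_line x w p)`_k = (k`!)%:R^-1 * evalp (derivs (nseq k w) p) x.
Proof.
have := horner_restrict_line x w (derivs (nseq k w) p) 0.
rewrite scale0r addr0 -derivn_restrict_line horner_coef0 coef_derivn addn0 ffactnn.
move=> <-; rewrite -[X in _ = _ * X]mulr_natr mulrCA mulVf ?mulr1 //.
by rewrite pnatr_eq0 -lt0n fact_gt0.
Qed.

(** The coefficients of restrict_line at 0 are its normalized derivatives there,
which are directional derivatives of p at x; evaluation at t = 1 sums them. *)
Lemma taylor p x w N : (msize p <= N)%N ->
  evalp p (x + w) =
    \sum_(k < N) (k`!)%:R^-1 * evalp (derivs (nseq k w) p) x.
Proof.
move=> pN; rewrite -[w in LHS]scale1r -horner_restrict_line.
rewrite (@horner_coef_wide _ N); last first.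
  apply/leq_sizeP => j Nj; rewrite coef_restrict_line derivs_eq0.
    by rewrite /evalp meval0 mulr0.
  by rewrite size_nseq (leq_trans pN).
by apply: eq_bigr => k _; rewrite expr1n mulr1 coef_restrict_line.
Qed.

End Taylor.

(** * Bounds on the Taylor forms given by gamma_2 *)

Section Multilinear.
Context {R : realType} {n : nat}.
Local Notation C := R[i].
Local Notation normc := ComplexField.Normc.normc.
Implicit Types (p q : {mpoly C[n]}) (x v w : 'cV[C]_n) (s : seq 'cV[C]_n).

Lemma derivs_scale (s : seq (C * 'cV[C]_n)) p :
  derivs [seq a.1 *: a.2 | a <- s] p =
    (\prod_(a <- s) a.1) *: derivs [seq a.2 | a <- s] p.
Proof.
elim: s => [|a s IH] /=; first by rewrite big_nil scale1r.
by rewrite IH linearZ /= dirderivZl scalerA big_cons mulrC.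
Qed.

(** A supremum of an unbounded set would be 0 and say nothing, so the operator
norms and gamma_2 are of use only once their sets are known to be bounded.  Here
the innermost direction is expanded in coordinates, which leaves k - 1 directions
applied to the partial derivatives of p. *)
Lemma derivs_unit_bounded k p x : exists K : R, forall s,
  size s = k -> (forall v, v \in s -> hnorm v = 1) ->
  normc (evalp (derivs s p) x) <= K.
Proof.
elim: k p => [|k IH] p.
  by exists (normc (evalp p x)) => s /size0nil ->.
have /fin_all_exists[K hK] := fun i => IH p^`M(i).
exists (\sum_i K i) => s; case/lastP: s => [//|s v].
rewrite size_rcons => -[sk] sv.
have -> : derivs (rcons s v) p = \sum_i v i 0 *: derivs s p^`M(i).
  rewrite /derivs foldr_rcons /dirderiv -/(derivs s _) linear_sum.
  by apply: eq_bigr => i _; rewrite linearZ.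
rewrite evalp_sum (le_trans (normc_sum _ _)) //; apply: ler_sum => i _.
rewrite evalpZ ComplexField.Normc.normcM.
have vi : normc (v i 0) <= 1.
  by rewrite -(sv v) ?mem_rcons ?mem_head // normc_le_hnorm.
rewrite -[K i]mul1r ler_pM ?normc_ge0 // hK // => w ws.
by apply: sv; rewrite mem_rcons in_cons ws orbT.
Qed.

End Multilinear.

(** The bound by the operator norm follows from multihomogeneity: each argument
is its norm times a unit vector. *)
Section Multinorm.
Context {R : realType} {n k : nat} {W : lmodType R[i]}.
Local Notation C := R[i].
Local Notation normc := ComplexField.Normc.normc.
Variables (N : W -> R) (A : k.-tuple 'cV[C]_n.+1 -> W).
Hypothesis N_ge0 : forall w, 0 <= N w.
Hypothesis N_scale : forall c w, N (c *: w) = normc c * N w.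
Hypothesis A_scale : forall s : k.-tuple (C * 'cV[C]_n.+1),
  A [tuple of [seq a.1 *: a.2 | a <- s]] =
    (\prod_(a <- s) a.1) *: A [tuple of [seq a.2 | a <- s]].
Hypothesis A_bounded : exists K : R, forall v : k.-tuple 'cV[C]_n.+1,
  (forall w, w \in tval v -> hnorm w = 1) -> N (A v) <= K.

Local Open Scope classical_set_scope.

(** A unit vector proportional to v, for v = 0 too: this spares a case
distinction when normalizing the arguments of a multilinear map. *)
Definition direction (v : 'cV[C]_n.+1) : 'cV[C]_n.+1 :=
  if v == 0 then delta_mx ord0 0 else (hnorm v)^-1%:C *: v.

Lemma hnorm_direction v : hnorm (direction v) = 1.
Proof.
rewrite /direction; case: eqVneq => [_|v0].
  rewrite /hnorm (bigD1 ord0) //= big1 => [|i /negbTE i0].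
    by rewrite mxE normc_nat !eqxx addr0 expr1n sqrtr1.
  by rewrite mxE normc_nat i0 expr0n.
have p : hnorm v != 0 by rewrite hnorm_eq0.
by rewrite hnormZ normc_realC ger0_norm ?invr_ge0 ?hnorm_ge0 // mulVf.
Qed.

Lemma direction_scale v : v = (hnorm v)%:C *: direction v.
Proof.
rewrite /direction; case: eqVneq => [->|v0]; first by rewrite hnorm0 scale0r.
have p : hnorm v != 0 by rewrite hnorm_eq0.
by rewrite scalerA -rmorphM /= divff // scale1r.
Qed.

Lemma multinorm_has_ub :
  has_ubound [set N (A v) | v in [set v : k.-tuple 'cV[C]_n.+1 |
     forall l : 'I_k, hnorm (tnth v l) = 1]].
Proof.
have [K hK] := A_bounded; exists K => _ [v vu <-]; apply: hK => w.
by move=> /tnthP[l ->].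
Qed.

Lemma multinorm_bound (v : k.-tuple 'cV[C]_n.+1) :
  N (A v) <= multinorm N A * \prod_(w <- v) hnorm w.
Proof.
pose s := [tuple of [seq ((hnorm w)%:C, direction w) | w <- v]].
have -> : v = [tuple of [seq a.1 *: a.2 | a <- s]].
  apply: val_inj => /=; rewrite -map_comp -[LHS]map_id.
  by apply: eq_map => w /=; exact: direction_scale.
rewrite A_scale N_scale [X in _ <= X]mulrC.
have -> : normc (\prod_(a <- s) a.1) =
    \prod_(w <- [tuple of [seq a.1 *: a.2 | a <- s]]) hnorm w.
  rewrite /= big_map /= !big_map; elim: (tval v) => [|w t IH].
    by rewrite !big_nil ComplexField.Normc.normc1.
  rewrite !big_cons ComplexField.Normc.normcM IH -direction_scale.
  by rewrite normc_realC ger0_norm ?hnorm_ge0.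
apply: ler_wpM2l; first by rewrite prodr_ge0 // => i _; rewrite hnorm_ge0.
apply: ub_le_sup; first exact: multinorm_has_ub.
exists [tuple of [seq a.2 | a <- s]] => // l.
by rewrite !tnth_map hnorm_direction.
Qed.

Lemma multinorm_ge0 : 0 <= multinorm N A.
Proof.
have u1 : hnorm (delta_mx ord0 0 : 'cV[C]_n.+1) = 1.
  by have := hnorm_direction 0; rewrite /direction eqxx.
pose v := [tuple of nseq k (delta_mx ord0 0 : 'cV[C]_n.+1)].
apply: (le_trans (N_ge0 (A v))); apply: ub_le_sup; first exact: multinorm_has_ub.
by exists v => // l; rewrite (tnth_nth 0) nth_nseq ltn_ord.
Qed.

Lemma multinorm_eq0 : (forall v, A v = 0) -> multinorm N A = 0.
Proof.
move=> A0; apply/eqP; rewrite eq_le multinorm_ge0 andbT.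
apply: ge_sup.
  exists (N 0); exists [tuple of nseq k (direction 0)]; last by rewrite A0.
  by move=> l; rewrite (tnth_nth 0) nth_nseq ltn_ord hnorm_direction.
move=> _ [v _ <-]; rewrite A0.
have := N_scale 0 0; rewrite scale0r => ->.
by rewrite ComplexField.Normc.normc0 mul0r.
Qed.

End Multinorm.

(** The terms of gamma_2 vanish beyond the degree of f, so their set is bounded
by the sum of the others. *)
Lemma le_sup_eventually0 (R : realType) (a : nat -> R) (K k : nat) :
  (forall j, 0 <= a j) -> (forall j, (K <= j)%N -> a j = 0) -> (2 <= k)%N ->
  a k <= sup [set a j | j in [set j : nat | (2 <= j)%N]].
Proof.
move=> a_ge0 aK k2; apply: ub_le_sup; last by exists k.
exists (\sum_(j < K) a j) => _ [j _ <-].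
have [jK|Kj] := ltnP j K; last by rewrite aK // sumr_ge0.
by rewrite (bigD1 (Ordinal jK)) //= lerDl sumr_ge0.
Qed.

Lemma root_le_expr (R : realType) (a g : R) (k : nat) :
  0 <= a -> (2 <= k)%N -> a `^ (k.-1%:R)^-1 <= g -> a <= g ^+ k.-1.
Proof.
move=> a0 k2 h.
have k0 : (k.-1%:R : R) != 0 by rewrite pnatr_eq0; case: k k2 {h} => [|[|]].
have -> : a = (a `^ (k.-1%:R)^-1) ^+ k.-1.
  by rewrite -powR_mulrn ?powR_ge0 // -powRrM mulVf // powRr1.
by rewrite lerXn2r ?nnegrE ?powR_ge0 // (le_trans _ h) ?powR_ge0.
Qed.

Section Gamma.
Context {R : realType} {m : nat}.
Local Notation C := R[i].
Local Notation normc := ComplexField.Normc.normc.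
Variables (f : polysystem R m) (x : 'cV[C]_m.+1).
Implicit Types s : seq 'cV[C]_m.+1.

Definition sysdeg : nat := \max_i msize (f i).

Lemma msize_sysdeg i : (msize (f i) <= sysdeg)%N.
Proof. exact: leq_bigmax. Qed.

Definition derivs_hat s : 'cV[C]_m := \col_i evalp (derivs s (fhat f i)) x.

Definition hatmap (k : nat) (v : k.-tuple 'cV[C]_m.+1) : 'cV[C]_m :=
  invmx (Dfhat f x) *m ((k`!)%:R^-1 *: Dkfhat f x v).

Definition lastmap (k : nat) (v : k.-tuple 'cV[C]_m.+1) : C :=
  (Delta2 f x)^-1 * (Dk (flast f) x v / (k`!)%:R).

Lemma hatmap_scale k (s : k.-tuple (C * 'cV[C]_m.+1)) :
  hatmap [tuple of [seq a.1 *: a.2 | a <- s]] =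
    (\prod_(a <- s) a.1) *: hatmap [tuple of [seq a.2 | a <- s]].
Proof.
rewrite /hatmap scalemxAr; congr (_ *m _); rewrite scalerA mulrC -scalerA.
congr (_ *: _); apply/matrixP => i j; rewrite !mxE -evalpZ.
by rewrite /Dk -/(derivs _ _) derivs_scale.
Qed.

Lemma lastmap_scale k (s : k.-tuple (C * 'cV[C]_m.+1)) :
  lastmap [tuple of [seq a.1 *: a.2 | a <- s]] =
    (\prod_(a <- s) a.1) * lastmap [tuple of [seq a.2 | a <- s]].
Proof.
rewrite /lastmap [RHS]mulrCA; congr (_ * _); rewrite [RHS]mulrA; congr (_ / _).
by rewrite -evalpZ /Dk -/(derivs _ _) derivs_scale.
Qed.

Lemma lastmap_bounded k : exists K : R, forall v : k.-tuple 'cV[C]_m.+1,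
  (forall w, w \in tval v -> hnorm w = 1) -> normc (lastmap v) <= K.
Proof.
have [K hK] := derivs_unit_bounded k (flast f) x.
exists (normc (Delta2 f x)^-1 * (K * normc (k`!)%:R^-1)) => v vu.
rewrite /lastmap !ComplexField.Normc.normcM.
rewrite ler_wpM2l ?normc_ge0 // ler_wpM2r ?normc_ge0 //.
by apply: hK => //; rewrite size_tuple.
Qed.

Lemma hatmap_bounded k : exists K : R, forall v : k.-tuple 'cV[C]_m.+1,
  (forall w, w \in tval v -> hnorm w = 1) -> hnorm (hatmap v) <= K.
Proof.
have /fin_all_exists[K hK] := fun i => derivs_unit_bounded k (fhat f i) x.
exists (\sum_i \sum_j normc (invmx (Dfhat f x) i j) *
          (normc (k`!)%:R^-1 * K j)) => v vu.
rewrite (le_trans (hnorm_le_sum _)) // ler_sum // => i _.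
rewrite mxE (le_trans (normc_sum _ _)) // ler_sum // => j _.
rewrite !mxE !ComplexField.Normc.normcM.
rewrite ler_wpM2l ?normc_ge0 // ler_wpM2l ?normc_ge0 //.
by apply: hK => //; rewrite size_tuple.
Qed.

Lemma hatmap_eq0 k (v : k.-tuple 'cV[C]_m.+1) : (sysdeg <= k)%N -> hatmap v = 0.
Proof.
move=> dk; rewrite /hatmap (_ : Dkfhat f x v = 0) ?scaler0 ?mulmx0 //.
apply/matrixP => i j; rewrite !mxE /Dk -/(derivs v _) derivs_eq0.
  by rewrite /evalp meval0.
by rewrite size_tuple (leq_trans (msize_sysdeg _)).
Qed.

Lemma lastmap_eq0 k (v : k.-tuple 'cV[C]_m.+1) : (sysdeg <= k)%N -> lastmap v = 0.
Proof.
move=> dk; rewrite /lastmap /Dk -/(derivs v _) derivs_eq0.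
  by rewrite /evalp meval0 mul0r mulr0.
by rewrite size_tuple (leq_trans (msize_sysdeg _)).
Qed.

Lemma gamma2_ge1 : 1 <= gamma2 f x.
Proof. by rewrite /gamma2 le_max lexx. Qed.

Lemma gamma2_hat_le k : (2 <= k)%N -> gamma2_hat f x k <= gamma2 f x.
Proof.
move=> k2; rewrite /gamma2 !le_max; apply/orP; right; apply/orP; left.
apply: (@le_sup_eventually0 _ _ (maxn 2 sysdeg)) => // [j|j].
  exact: powR_ge0.
rewrite geq_max => /andP[j2 dj]; rewrite /gamma2_hat.
rewrite -/(@hatmap j) (multinorm_eq0 (@hnorm_ge0 _ _) (@hnormZ _ _)) //.
- by rewrite powR0 // invr_eq0 pnatr_eq0; case: j j2 {dj} => [|[|]].
- exact: hatmap_bounded.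
- by move=> v; exact: hatmap_eq0.
Qed.

Lemma gamma2_last_le k : (2 <= k)%N -> gamma2_last f x k <= gamma2 f x.
Proof.
move=> k2; rewrite /gamma2 !le_max; apply/orP; right; apply/orP; right.
apply: (@le_sup_eventually0 _ _ (maxn 2 sysdeg)) => // [j|j].
  exact: powR_ge0.
rewrite geq_max => /andP[j2 dj]; rewrite /gamma2_last.
rewrite -/(@lastmap j) (@multinorm_eq0 _ _ _ C^o) //.
- by rewrite powR0 // invr_eq0 pnatr_eq0; case: j j2 {dj} => [|[|]].
- exact: normc_ge0.
- exact: ComplexField.Normc.normcM.
- exact: lastmap_bounded.
- by move=> v; exact: lastmap_eq0.
Qed.

(** The (k-1)-th roots in gamma_2 are turned into geometric growth of the
Taylor forms, the shape in which gamma_2 enters the series below. *)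
Lemma hat_bound s : (2 <= size s)%N ->
  hnorm (invmx (Dfhat f x) *m (((size s)`!)%:R^-1 *: derivs_hat s)) <=
    gamma2 f x ^+ (size s).-1 * \prod_(w <- s) hnorm w.
Proof.
move=> s2; apply: (le_trans (multinorm_bound (@hnormZ _ _)
  (@hatmap_scale _) (hatmap_bounded _) (in_tuple s))).
apply: ler_wpM2r; first by rewrite prodr_ge0 // => i _; rewrite hnorm_ge0.
apply: root_le_expr => //; last exact: gamma2_hat_le.
exact: (multinorm_ge0 (@hnorm_ge0 _ _) (hatmap_bounded _)).
Qed.

Lemma last_bound s : (2 <= size s)%N ->
  normc ((Delta2 f x)^-1 * (evalp (derivs s (flast f)) x / ((size s)`!)%:R)) <=
    gamma2 f x ^+ (size s).-1 * \prod_(w <- s) hnorm w.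
Proof.
move=> s2; apply: (le_trans (@multinorm_bound _ _ _ C^o _ _
  (@ComplexField.Normc.normcM _)
  (@lastmap_scale _) (lastmap_bounded _) (in_tuple s))).
apply: ler_wpM2r; first by rewrite prodr_ge0 // => i _; rewrite hnorm_ge0.
apply: root_le_expr => //; last exact: gamma2_last_le.
exact: (@multinorm_ge0 _ _ _ C^o _ _ (@normc_ge0 _) (lastmap_bounded _)).
Qed.

End Gamma.

(** * Perturbation of the identity and geometric majorants *)

(** The lower bound on ||M v|| makes M injective, and it also bounds the inverse
of M without naming it. *)
Lemma near_identity_unitmx (R : realType) (m : nat) (M : 'M[R[i]]_m) (d : R) :
  d < 1 -> (forall v : 'cV_m, hnorm (M *m v - v) <= d * hnorm v) ->
  M \in unitmx /\ forall v : 'cV_m, (1 - d) * hnorm v <= hnorm (M *m v).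
Proof.
move=> d1 hM.
have low v : (1 - d) * hnorm v <= hnorm (M *m v).
  have : hnorm v <= hnorm (M *m v) + hnorm (M *m v - v).
    by rewrite -[in leLHS](subKr (M *m v) v) (le_trans (ler_hnormD _ _)) // hnormN.
  have := hM v; lra.
split=> //; rewrite -unitmx_tr unitmxE unitfE; apply/negP => /det0P[v v0 vM].
have := low v^T; rewrite -[M]trmxK -trmx_mul vM trmx0 hnorm0 => le0.
have : 0 < hnorm v^T by rewrite lt_def hnorm_ge0 hnorm_eq0 trmx_eq0 v0.
move=> p; have : 0 < (1 - d) * hnorm v^T by rewrite mulr_gt0 // subr_gt0.
by rewrite ltNge le0.
Qed.

Lemma geometric_le (R : realType) (y : R) (n : nat) :
  0 <= y -> y <= 10^-1 -> \sum_(k < n) y ^+ k <= 10 / 9.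
Proof.
move=> y0 y1.
suff : (1 - y) * \sum_(k < n) y ^+ k <= 1.
  have : 0 <= \sum_(k < n) y ^+ k by rewrite sumr_ge0 // => i _; rewrite exprn_ge0.
  nra.
elim: n => [|n IH]; first by rewrite big_ord0 mulr0.
rewrite big_ord_recl expr0 mulrDr mulr1.
have -> : \sum_(i < n) y ^+ bump 0 i = y * \sum_(i < n) y ^+ i.
  by rewrite mulr_sumr; apply: eq_bigr => i _; rewrite -exprS.
nra.
Qed.

(** The Taylor terms carry factors such as k+2 or (k+2)(k+3); these are at most
c 2^k, which turns every series below into a geometric one of ratio 2 y. *)
Lemma sum_le_geometric (R : realType) (a : nat -> R) (c y : R) (n : nat) :
  0 <= c -> 0 <= y -> 2 * y <= 10^-1 ->
  (forall k : nat, a k <= c * 2 ^+ k * y ^+ k.+1) ->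
  \sum_(k < n) a k <= c * (10 / 9) * y.
Proof.
move=> c0 y0 y1 ha.
apply: (@le_trans _ _ (c * y * \sum_(k < n) (2 * y) ^+ k)).
  rewrite mulr_sumr ler_sum // => k _; rewrite (le_trans (ha k)) //.
  by rewrite exprMn exprS le_eqVlt; apply/orP; left; apply/eqP; ring.
have := geometric_le n (mulr_ge0 (ler0n _ 2) y0) y1.
set S := \sum_(k < n) _ => hS.
have := ler_wpM2l (mulr_ge0 c0 y0) hS; lra.
Qed.

(** * Taylor expansions of the system at the zero *)

Section Expansions.
Context {R : realType} {m : nat}.
Local Notation C := R[i].
Local Notation normc := ComplexField.Normc.normc.
Variables (f : polysystem R m) (xi : 'cV[C]_m.+1).
Implicit Types (w : 'cV[C]_m.+1) (s : seq 'cV[C]_m.+1) (p : {mpoly C[m.+1]}).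
Local Notation d := (sysdeg f).
Local Notation e1 := (joinv 1 (0 : 'cV[C]_m)).

Lemma taylor_derivs p w s N : (msize p <= N)%N ->
  evalp (derivs s p) (xi + w) =
    \sum_(k < N) (k`!)%:R^-1 * evalp (derivs (nseq k w ++ s) p) xi.
Proof.
move=> pN; rewrite (@taylor _ _ _ _ _ N); last first.
  by rewrite (leq_trans _ pN) // (leq_trans (msize_derivs _ _)) // leq_subr.
by apply: eq_bigr => k _; rewrite /derivs foldr_cat.
Qed.

Lemma derivs_hat_taylor w s N : (d <= N)%N ->
  derivs_hat f (xi + w) s =
    \sum_(k < N) (k`!)%:R^-1 *: derivs_hat f xi (nseq k w ++ s).
Proof.
move=> dN; apply/matrixP => i j; rewrite summxE mxE.
rewrite (@taylor_derivs _ _ _ N) ?(leq_trans (msize_sysdeg _ _)) //.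
by apply: eq_bigr => k _; rewrite !mxE.
Qed.

Lemma derivs_dirderiv_linear s a (u v : 'cV[C]_m.+1) p :
  derivs s (dirderiv (a *: u - v) p) =
    a *: derivs s (dirderiv u p) - derivs s (dirderiv v p).
Proof.
by rewrite -scaleN1r dirderivDl !dirderivZl linearD !linearZ /= scaleN1r.
Qed.

Lemma derivs_hat_last_linear s a (u v : 'cV[C]_m.+1) :
  derivs_hat f xi (s ++ [:: a *: u - v]) =
    a *: derivs_hat f xi (s ++ [:: u]) - derivs_hat f xi (s ++ [:: v]).
Proof.
apply/matrixP => i j; rewrite !mxE /derivs !foldr_cat /= -!/(derivs s _).
by rewrite derivs_dirderiv_linear evalpD evalpZ evalpN.
Qed.

Lemma dirderiv_joinv0 (v : 'cV[C]_m) p :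
  dirderiv (joinv 0 v) p = \sum_j v j 0 *: p^`M(lift ord0 j).
Proof.
rewrite /dirderiv big_ord_recl joinv0 scale0r add0r.
by apply: eq_bigr => j _; rewrite joinv_lift.
Qed.

Lemma dirderiv_axis a p : dirderiv (joinv a (0 : 'cV[C]_m)) p = a *: p^`M(ord0).
Proof.
rewrite /dirderiv big_ord_recl joinv0 big1 ?addr0 // => j _.
by rewrite joinv_lift mxE scale0r.
Qed.

Lemma Dfhat_mul x (v : 'cV[C]_m) :
  Dfhat f x *m v = derivs_hat f x [:: joinv 0 v].
Proof.
apply/matrixP => i j; rewrite ord1 !mxE /= dirderiv_joinv0 evalp_sum.
by apply: eq_bigr => k _; rewrite !mxE evalpZ mulrC.
Qed.

Lemma fhat_at_derivs x : fhat_at f x = derivs_hat f x [::].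
Proof. by apply/matrixP => i j; rewrite !mxE. Qed.

Lemma dflastE x : dflast f x = evalp (derivs [:: e1] (flast f)) x.
Proof. by rewrite /dflast /= dirderiv_axis scale1r. Qed.

Lemma d2flastE x : d2flast f x = evalp (derivs [:: e1; e1] (flast f)) x.
Proof. by rewrite /d2flast /= !dirderiv_axis !scale1r. Qed.

End Expansions.

(** * One step of the modified Newton iteration *)

Lemma pow2_ge_succ k : (k.+1 <= 2 ^ k)%N.
Proof. by elim: k => // k IH; rewrite expnS; lia. Qed.

Lemma pow2_ge_mul k : (k.+3 * k.+2 <= 6 * 2 ^ k)%N.
Proof. by elim: k => // k IH; rewrite expnS; nia. Qed.

Lemma invfact_succ (F : numFieldType) k :
  (k`!)%:R^-1 = (k.+1)%:R * ((k.+1)`!)%:R^-1 :> F.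
Proof. by rewrite factS natrM invfM mulVKf // pnatr_eq0. Qed.

Section Contraction.
Context {R : realType} {m : nat}.
Local Notation C := R[i].
Local Notation normc := ComplexField.Normc.normc.
Variables (f : polysystem R m) (xi : 'cV[C]_m.+1).
Hypothesis hxi : simple_double_zero_normalized f xi.
Local Notation d := (sysdeg f).
Local Notation e1 := (joinv 1 (0 : 'cV[C]_m)).
Local Notation G := (gamma2 f xi).
Local Notation Ai := (invmx (Dfhat f xi)).

Lemma gamma2_ge0 : 0 <= G. Proof. exact: le_trans ler01 (gamma2_ge1 _ _). Qed.

Lemma prod_hnorm_nseq_cat k (w : 'cV[C]_m.+1) s :
  \prod_(v <- nseq k w ++ s) hnorm v = hnorm w ^+ k * \prod_(v <- s) hnorm v.
Proof.
rewrite big_cat /=; congr (_ * _).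
by elim: k => [|k IH] /=; rewrite ?big_nil // big_cons IH exprS.
Qed.

Lemma hat_term k w s : (2 <= k + size s)%N ->
  hnorm (Ai *m (((k + size s)`!)%:R^-1 *: derivs_hat f xi (nseq k w ++ s))) <=
  G ^+ (k + size s).-1 * (hnorm w ^+ k * \prod_(v <- s) hnorm v).
Proof.
move=> h; rewrite -prod_hnorm_nseq_cat.
have := @hat_bound _ _ f xi (nseq k w ++ s).
by rewrite size_cat size_nseq; apply.
Qed.

Lemma last_term k w s : (2 <= k + size s)%N ->
  normc ((Delta2 f xi)^-1 *
     (evalp (derivs (nseq k w ++ s) (flast f)) xi / ((k + size s)`!)%:R)) <=
  G ^+ (k + size s).-1 * (hnorm w ^+ k * \prod_(v <- s) hnorm v).
Proof.
move=> h; rewrite -prod_hnorm_nseq_cat.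
have := @last_bound _ _ f xi (nseq k w ++ s).
by rewrite size_cat size_nseq; apply.
Qed.

Lemma hnorm_joinv0 (v : 'cV[C]_m) : hnorm (joinv 0 v) = hnorm v.
Proof.
apply/eqP; rewrite -(@eqrXn2 _ 2) ?hnorm_ge0 // hnorm_joinv_sqr.
by rewrite ComplexField.Normc.normc0 expr0n add0r.
Qed.

Section Point.
Variable w : 'cV[C]_m.+1.
Hypothesis small : G ^+ 2 * hnorm w <= 42 / 1000.
Local Notation r := (hnorm w).
Local Notation u := (G ^+ 2 * hnorm w).
Local Notation x := (G * hnorm w).

Lemma gammar_ge0 : 0 <= x. Proof. by rewrite mulr_ge0 ?gamma2_ge0 ?hnorm_ge0. Qed.

Lemma gammar_le_u : x <= u.
Proof.
by rewrite expr2 -mulrA -[leLHS]mul1r ler_wpM2r ?gammar_ge0 ?gamma2_ge1.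
Qed.

Lemma Dfhat_near_identity (v : 'cV[C]_m) :
  hnorm (Ai *m Dfhat f (xi + w) *m v - v) <= 20 / 9 * x * hnorm v.
Proof.
have [_ Au _ _ _] := hxi.
rewrite -mulmxA Dfhat_mul (@derivs_hat_taylor _ _ f xi w _ d.+1) // big_ord_recl.
rewrite /= fact0 invr1 scale1r -Dfhat_mul mulmxDr mulKmx // addrAC subrr add0r.
rewrite mulmx_sumr (le_trans (hnorm_sum _ _)) //.
have -> : 20 / 9 * x * hnorm v = 2 * hnorm v * (10 / 9) * x by field.
pose a k := hnorm (Ai *m ((k.+1`!)%:R^-1 *:
  derivs_hat f xi (nseq k.+1 w ++ [:: joinv 0 v]))).
apply: (@sum_le_geometric _ a); rewrite ?mulr_ge0 ?hnorm_ge0 ?gamma2_ge0 //.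
  by move: gammar_le_u small; lra.
move=> k; rewrite {}/a invfact_succ -scalerA -scalemxAr hnormZ normc_nat.
have := @hat_term k.+1 w [:: joinv 0 v].
rewrite addn1 big_seq1 hnorm_joinv0 /= => /(_ isT) H.
apply: (le_trans (ler_wpM2l (ler0n _ _) H)).
have -> : k.+2%:R * (G ^+ k.+1 * (r ^+ k.+1 * hnorm v)) =
          k.+2%:R * (hnorm v * x ^+ k.+1) by rewrite exprMn; ring.
have -> : 2 * hnorm v * 2 ^+ k * x ^+ k.+1 = 2 ^+ k.+1 * (hnorm v * x ^+ k.+1).
  by rewrite [2 ^+ k.+1]exprS; ring.
apply: ler_wpM2r; first by rewrite mulr_ge0 ?hnorm_ge0 ?exprn_ge0 ?gammar_ge0.
by rewrite -natrX ler_nat pow2_ge_succ.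
Qed.

Lemma Dfhat_unit : Dfhat f (xi + w) \in unitmx.
Proof.
have [_ Au _ _ _] := hxi.
have [||MU _] := @near_identity_unitmx _ _ (Ai *m Dfhat f (xi + w)) (20 / 9 * x).
- by move: gammar_le_u small; lra.
- exact: Dfhat_near_identity.
by move: MU; rewrite unitmx_mul => /andP[].
Qed.

Lemma hatv_sub (y z : 'cV[C]_m.+1) : hatv (y - z) = hatv y - hatv z.
Proof. by apply/matrixP => i j; rewrite !mxE. Qed.

Definition hat_error : 'cV[C]_m := newton1 f (xi + w) - hatv xi.

(** In D fhat(z) what - fhat(z) the Taylor terms of order k+1 are
1/k! D^(k+1) (w, ..., w, (0, what)) and 1/(k+1)! D^(k+1) (w, ..., w, w); they merge
by linearity in the last argument, since (k+1) (0, what) - w = (-w_1, k what). *)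
Lemma Dfhat_hat_error :
  Dfhat f (xi + w) *m hat_error =
  \sum_(k < d.+1) ((k.+1)`!)%:R^-1 *: derivs_hat f xi
     (nseq k w ++ [:: joinv (- w ord0 0) (k%:R *: hatv w)]).
Proof.
have [f0 _ _ _ _] := hxi.
have -> : hat_error = hatv w - invmx (Dfhat f (xi + w)) *m fhat_at f (xi + w).
  rewrite /hat_error /newton1 addrAC -hatv_sub; congr (hatv _ - _).
  by rewrite addrAC subrr add0r.
rewrite mulmxBr mulKVmx ?Dfhat_unit // Dfhat_mul fhat_at_derivs.
rewrite (@derivs_hat_taylor _ _ f xi w [:: joinv 0 (hatv w)] d.+1) //.
rewrite (@derivs_hat_taylor _ _ f xi w [::] d.+2); last by rewrite leqW.
rewrite [X in _ - X]big_ord_recl /= fact0 invr1 scale1r.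
have -> : derivs_hat f xi [::] = 0.
  by apply/matrixP => i j; rewrite !mxE; exact: f0.
rewrite add0r -sumrB; apply: eq_bigr => k _.
rewrite /bump leq0n add1n cats0.
have -> : joinv (- w ord0 0) (k%:R *: hatv w) = (k.+1)%:R *: joinv 0 (hatv w) - w.
  rewrite -[X in _ = _ - X](joinv_hatv w) -[- joinv _ _]scaleN1r.
  rewrite !joinv_scale joinv_add.
  by rewrite mulr0 add0r mulN1r -scalerDl -natr1 addrK.
rewrite derivs_hat_last_linear scalerBr scalerA mulrC -invfact_succ.
have -> : w :: nseq k w = nseq k w ++ [:: w].
  by rewrite -[LHS]/(nseq k.+1 w) -(addn1 k) nseqD.
by [].
Qed.

Lemma hat_error_le : hnorm hat_error <= 5 / 4 * x * r.
Proof.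
have [_ Au f1 _ _] := hxi.
have xs : x <= 42 / 1000 := le_trans gammar_le_u small.
have [||_ low] := @near_identity_unitmx _ _ (Ai *m Dfhat f (xi + w)) (20 / 9 * x).
- lra.
- exact: Dfhat_near_identity.
have H : hnorm (Ai *m (Dfhat f (xi + w) *m hat_error)) <= r * (10 / 9) * x.
  rewrite Dfhat_hat_error mulmx_sumr big_ord_recl.
  (* The term k = 0 is - w_1 times the derivative of fhat along X_1. *)
  rewrite [X in Ai *m X + _](_ : _ = 0); last first.
    apply/matrixP => i j; rewrite !mxE scale0r /= dirderiv_axis evalpZ.
    by rewrite f1 !mulr0.
  rewrite mulmx0 add0r (le_trans (hnorm_sum _ _)) //.
  pose a k := hnorm (Ai *m (((k.+2)`!)%:R^-1 *: derivs_hat f xi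
     (nseq k.+1 w ++ [:: joinv (- w ord0 0) ((k.+1)%:R *: hatv w)]))).
  apply: (@sum_le_geometric _ a); rewrite ?hnorm_ge0 ?gammar_ge0 //; first by lra.
  move=> k; rewrite {}/a.
  set W := joinv _ _.
  have hW : hnorm W <= k.+1%:R * r.
    have E : k.+1%:R *: w = joinv (k.+1%:R * w ord0 0) (k.+1%:R *: hatv w).
      by rewrite -joinv_scale joinv_hatv.
    rewrite -normc_nat -hnormZ E; apply: hnorm_le_coord => i.
    rewrite !mxE; case: unliftP => [j|] _ //.
    rewrite normcN ComplexField.Normc.normcM normc_nat.
    by rewrite -[leLHS]mul1r ler_wpM2r ?normc_ge0 // ler1n.
  have := @hat_term k.+1 w [:: W].
  rewrite addn1 big_seq1 /= => /(_ isT) h; apply: (le_trans h).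
  have -> : G ^+ k.+1 * (r ^+ k.+1 * hnorm W) = x ^+ k.+1 * hnorm W.
    by rewrite exprMn mulrA.
  rewrite [leRHS]mulrC ler_wpM2l ?exprn_ge0 ?gammar_ge0 // (le_trans hW) // mulrC.
  by rewrite ler_wpM2l ?hnorm_ge0 // -natrX ler_nat pow2_ge_succ.
move: (low hat_error); rewrite -mulmxA => L.
have xr0 : 0 <= x * r by rewrite mulr_ge0 ?gammar_ge0 ?hnorm_ge0.
have e0 := hnorm_ge0 hat_error; have x0 := gammar_ge0.
nra.
Qed.

(** The point (z_1, N_1(z)) at which N_2 evaluates the derivatives of f_n. *)
Definition half_step : 'cV[C]_m.+1 :=
  joinv ((xi + w) ord0 0) (newton1 f (xi + w)).

Definition half_error : 'cV[C]_m.+1 := joinv (w ord0 0) hat_error.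

Lemma half_stepE : half_step = xi + half_error.
Proof.
rewrite /half_step /half_error -[X in _ = X + _](joinv_hatv xi) joinv_add.
by rewrite /hat_error mxE [hatv xi + _]addrC subrK.
Qed.

Lemma half_error_le : hnorm half_error <= 106 / 100 * r.
Proof.
rewrite (le_trans (hnorm_joinv_le _ _)) //.
have r0 := hnorm_ge0 w.
have h1 := normc_le_hnorm w ord0; have h2 := hat_error_le.
have h3 : x * r <= 42 / 1000 * r.
  by apply: ler_wpM2r; rewrite ?hnorm_ge0 // (le_trans gammar_le_u).
lra.
Qed.

Local Notation t := (G ^+ 2 * hnorm half_error).

Lemma t_ge0 : 0 <= t.
Proof. by rewrite mulr_ge0 ?exprn_ge0 ?gamma2_ge0 ?hnorm_ge0. Qed.

Lemma t_le : t <= 106 / 100 * u.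
Proof.
by rewrite mulrCA ler_wpM2l ?exprn_ge0 ?gamma2_ge0 // half_error_le.
Qed.

(** Trading G^(k+2) for the larger G^(2k+2) makes the terms powers of the single
quantity t; the term of order 2 must be kept out of this exchange. *)
Lemma gamma_power_le k :
  G ^+ k.+2 * hnorm half_error ^+ k.+1 <= t ^+ k.+1.
Proof.
rewrite exprMn ler_wpM2r ?exprn_ge0 ?hnorm_ge0 // -exprM.
by rewrite ler_weXn2l ?gamma2_ge1 //; lia.
Qed.

Lemma hnorm_e1 : hnorm e1 = 1.
Proof.
apply/eqP; rewrite -(@eqrXn2 _ 2) ?hnorm_ge0 // hnorm_joinv_sqr hnorm0.
by rewrite ComplexField.Normc.normc1 !expr1n expr0n addr0.
Qed.

(** The order-2 Taylor term of d2flast / Delta2 is exactly 2; the remaining ones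
sum to at most 6 (10/9) t. *)
Lemma d2flast_relative :
  normc ((Delta2 f xi)^-1 * d2flast f half_step - 2) <= 3 / 10.
Proof.
have [_ _ _ _ D0] := hxi.
rewrite half_stepE d2flastE.
rewrite (@taylor_derivs _ _ xi (flast f) half_error [:: e1; e1] d.+1); last first.
  by rewrite leqW // msize_sysdeg.
rewrite big_ord_recl fact0 invr1 mul1r [_ ++ _]/= -d2flastE.
have -> : d2flast f xi = 2 * Delta2 f xi.
  by rewrite /Delta2 mulrA mulfV ?mul1r // pnatr_eq0.
rewrite mulrDr mulrCA mulVf // mulr1 [_ + _ - _]addrAC subrr add0r.
rewrite mulr_sumr (le_trans (normc_sum _ _)) //.
pose a k := normc ((Delta2 f xi)^-1 * ((k.+1)`!%:R^-1 *
  evalp (derivs (nseq k.+1 half_error ++ [:: e1; e1]) (flast f)) xi)).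
apply: (@le_trans _ _ (6 * (10 / 9) * t)); last first.
  by move: t_le small; lra.
apply: (@sum_le_geometric _ a); rewrite ?t_ge0 //; first by move: t_le small; lra.
move=> k; rewrite {}/a.
have -> : (Delta2 f xi)^-1 * ((k.+1)`!%:R^-1 *
    evalp (derivs (nseq k.+1 half_error ++ [:: e1; e1]) (flast f)) xi) =
  (k.+2 * k.+3)%:R * ((Delta2 f xi)^-1 *
   (evalp (derivs (nseq k.+1 half_error ++ [:: e1; e1]) (flast f)) xi
     / ((k.+3)`!)%:R)).
  by rewrite natrM invfact_succ [(k.+2)`!%:R^-1]invfact_succ; ring.
rewrite ComplexField.Normc.normcM normc_nat.
have := @last_term k.+1 half_error [:: e1; e1].
rewrite addn2 -[k.+3.-1]/k.+2 big_cons big_seq1 hnorm_e1 !mulr1 => /(_ isT) H.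
rewrite (le_trans (ler_wpM2l (ler0n _ _) H)) //.
apply: ler_pM; first exact: ler0n.
- exact: mulr_ge0 (exprn_ge0 _ gamma2_ge0) (exprn_ge0 _ (hnorm_ge0 _)).
- by rewrite -natrX -natrM ler_nat mulnC pow2_ge_mul.
- exact: gamma_power_le.
Qed.

Lemma d2flast_neq0 : d2flast f half_step != 0.
Proof.
apply/eqP => z; have := d2flast_relative; rewrite z mulr0 add0r normcN normc_nat.
lra.
Qed.

Definition last_residual : C :=
  d2flast f half_step * w ord0 0 - dflast f half_step.

(** As in Dfhat_hat_error, the Taylor terms of equal order merge by linearity:
(k+1) w_1 e_1 - (w_1, e) = (k w_1, - e), where e is hat_error. *)
Lemma last_residualE : last_residual =
  \sum_(k < d.+1) ((k.+1)`!)%:R^-1 * evalp (derivs (nseq k half_error ++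
     [:: joinv (k%:R * w ord0 0) (- hat_error); e1]) (flast f)) xi.
Proof.
have [_ _ _ g1 _] := hxi.
rewrite /last_residual half_stepE d2flastE dflastE.
rewrite (@taylor_derivs _ _ xi (flast f) half_error [:: e1; e1] d.+1); last first.
  by rewrite leqW // msize_sysdeg.
rewrite (@taylor_derivs _ _ xi (flast f) half_error [:: e1] d.+2); last first.
  by rewrite !leqW // msize_sysdeg.
rewrite [X in _ - X]big_ord_recl fact0 invr1 mul1r [_ ++ _]/= -dflastE.
rewrite /dflast g1 add0r mulr_suml -sumrB; apply: eq_bigr => k _.
rewrite lift0.
have -> : joinv (k%:R * w ord0 0) (- hat_error) =
          (k.+1%:R * w ord0 0) *: e1 - half_error.
  rewrite -[- half_error]scaleN1r /half_error !joinv_scale joinv_add.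
  by rewrite scaler0 add0r mulr1 scaleN1r -natr1; congr joinv; ring.
have -> : nseq k.+1 half_error ++ [:: e1] = nseq k half_error ++ [:: half_error; e1].
  by rewrite -(addn1 k) nseqD -catA.
rewrite invfact_succ /derivs !foldr_cat /= -!/(derivs _ _).
by rewrite derivs_dirderiv_linear evalpD evalpZ evalpN; ring.
Qed.

Lemma last_residual_le :
  normc ((Delta2 f xi)^-1 * last_residual) <= 96 / 10 * (u * r).
Proof.
have e_le := hat_error_le; have e_ge0 := hnorm_ge0 hat_error.
have r0 := hnorm_ge0 w.
have term_le k : normc ((Delta2 f xi)^-1 * (((k.+1)`!)%:R^-1 *
    evalp (derivs (nseq k half_error ++
     [:: joinv (k%:R * w ord0 0) (- hat_error); e1]) (flast f)) xi)) <=
  k.+2%:R * (G ^+ k.+1 * (hnorm half_error ^+ k *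
                          (k%:R * r + hnorm hat_error))).
  set W := joinv _ _.
  have -> : (Delta2 f xi)^-1 * (((k.+1)`!)%:R^-1 *
      evalp (derivs (nseq k half_error ++ [:: W; e1]) (flast f)) xi) =
    k.+2%:R * ((Delta2 f xi)^-1 *
      (evalp (derivs (nseq k half_error ++ [:: W; e1]) (flast f)) xi
       / ((k.+2)`!)%:R)).
    by rewrite invfact_succ; ring.
  rewrite ComplexField.Normc.normcM normc_nat ler_wpM2l ?ler0n //.
  have := @last_term k half_error [:: W; e1].
  rewrite addn2 -[k.+2.-1]/k.+1 big_cons big_seq1 hnorm_e1 mulr1 => /(_ isT) H.
  rewrite (le_trans H) // ler_wpM2l ?exprn_ge0 ?gamma2_ge0 //.
  rewrite ler_wpM2l ?exprn_ge0 ?hnorm_ge0 //.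
  rewrite (le_trans (hnorm_joinv_le _ _)) // hnormN lerD2r.
  rewrite ComplexField.Normc.normcM normc_nat ler_wpM2l ?ler0n //.
  exact: normc_le_hnorm.
rewrite last_residualE mulr_sumr (le_trans (normc_sum _ _)) // big_ord_recl.
(* In the term k = 0 the first coordinate is 0 and only hat_error remains: its
   size 5/4 G r^2, the factor 2 and the factor G give 5/2 u r. *)
have first_le : normc ((Delta2 f xi)^-1 * ((1`!)%:R^-1 *
    evalp (derivs (nseq 0 half_error ++
     [:: joinv (0%:R * w ord0 0) (- hat_error); e1]) (flast f)) xi)) <=
     5 / 2 * (u * r).
  rewrite (le_trans (term_le 0)) //.
  have : G * hnorm hat_error <= G * (5 / 4 * x * r) by rewrite ler_wpM2l ?gamma2_ge0.
  rewrite expr1 expr0; lra.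
pose a k := normc ((Delta2 f xi)^-1 * (((k.+2)`!)%:R^-1 *
    evalp (derivs (nseq k.+1 half_error ++
     [:: joinv (k.+1%:R * w ord0 0) (- hat_error); e1]) (flast f)) xi)).
have rest_le : \sum_(k < d) a k <= 6 * r * (10 / 9) * t.
  apply: sum_le_geometric; rewrite ?t_ge0 ?mulr_ge0 //.
    by move: t_le small; lra.
  move=> k; rewrite {}/a (le_trans (term_le k.+1)) //.
  have er : hnorm hat_error <= r.
    have : x * r <= 42 / 1000 * r.
      by apply: ler_wpM2r; rewrite ?hnorm_ge0 // (le_trans gammar_le_u).
    lra.
  have -> : k.+3%:R * (G ^+ k.+2 * (hnorm half_error ^+ k.+1 *
              (k.+1%:R * r + hnorm hat_error))) =
    (k.+3%:R * (k.+1%:R * r + hnorm hat_error)) *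
    (G ^+ k.+2 * hnorm half_error ^+ k.+1) by ring.
  apply: ler_pM; last exact: gamma_power_le.
  - exact: mulr_ge0 (ler0n _ _) (addr_ge0 (mulr_ge0 (ler0n _ _) r0) e_ge0).
  - exact: mulr_ge0 (exprn_ge0 _ gamma2_ge0) (exprn_ge0 _ (hnorm_ge0 _)).
  apply: (@le_trans _ _ ((k.+3 * k.+2)%:R * r)).
    rewrite natrM -mulrA ler_wpM2l ?ler0n // -[k.+2%:R]natr1 mulrDl mul1r.
    by rewrite lerD2l.
  rewrite mulrAC ler_wpM2r // -natrX -natrM ler_nat pow2_ge_mul //.
have tr : t * r <= 106 / 100 * (u * r).
  by rewrite [leRHS]mulrA ler_wpM2r // t_le.
have ur : 0 <= u * r by rewrite !mulr_ge0 ?exprn_ge0 ?gamma2_ge0.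
apply: le_trans (lerD first_le rest_le) _; lra.
Qed.

(** The hatted coordinates contribute 5/4 to the constant; the first one
contributes 9.6 / 1.7 < 5.7, a bound on last_residual divided by one on d2flast. *)
Lemma newton_contraction :
  newton_defined f (xi + w) /\ hnorm (newton f (xi + w) - xi) <= 7 * (u * r).
Proof.
split; first by split; [exact: Dfhat_unit | exact: d2flast_neq0].
have r0 := hnorm_ge0 w.
have [_ _ _ _ D0] := hxi.
have -> : newton f (xi + w) - xi =
          joinv ((d2flast f half_step)^-1 * last_residual) hat_error.
  rewrite -[X in _ - X](joinv_hatv xi) -[- joinv _ _]scaleN1r joinv_scale.
  rewrite joinv_add mulN1r scaleN1r /newton2 -/half_step /last_residual.
  congr joinv; rewrite mulrBr mulKf ?d2flast_neq0 //.
  by rewrite mxE addrAC; congr (_ - _); rewrite addrAC subrr add0r.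
rewrite (le_trans (hnorm_joinv_le _ _)) //.
set q := normc _.
have q_le : 17 / 10 * q <= 96 / 10 * (u * r).
  apply: le_trans last_residual_le.
  have -> : (Delta2 f xi)^-1 * last_residual =
    ((Delta2 f xi)^-1 * d2flast f half_step) *
    ((d2flast f half_step)^-1 * last_residual).
    by rewrite -mulrA mulVKf ?d2flast_neq0.
  rewrite ComplexField.Normc.normcM -/q ler_wpM2r ?normc_ge0 //.
  set D := _ * d2flast _ _.
  have two_le : normc (2 : C) <= normc D + normc (D - 2).
    by rewrite -[X in normc X <= _](subKr D) (le_trans (normcD _ _)) // normcN.
  by move: two_le d2flast_relative; rewrite normc_nat -/D; lra.
have e_le := hat_error_le.
have xr : x * r <= u * r by rewrite ler_wpM2r // gammar_le_u.
have ur : 0 <= u * r by rewrite mulr_ge0 // mulr_ge0 // exprn_ge0 ?gamma2_ge0.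
lra.
Qed.

End Point.

End Contraction.

(** * The two majorant equations *)

Section Roots.
Context {R : realType}.
Implicit Types s t u : R.

Definition num21 t : R := (1 - 2 * t) ^+ 2 * t.
Definition den21 t : R := (2 * (1 - 2 * t) ^+ 2 - 1) * (1 - t).
Definition num23 t : R :=
  t * (32 * t ^+ 6 - 144 * t ^+ 5 + 272 * t ^+ 4 - 288 * t ^+ 3
       + 174 * t ^+ 2 - 52 * t + 5).
Definition den23 t : R :=
  (24 * t ^+ 3 - 36 * t ^+ 2 + 18 * t - 1) * (-1 + t) ^+ 3
  * (8 * t ^+ 2 - 8 * t + 1).

(** The bound 42/1000 exceeds both roots, and up to it all four polynomials are
monotone and all denominators positive. *)
Lemma num21_lt s t : 0 <= s -> s < t -> t <= 42 / 1000 ->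
  0 <= num21 s < num21 t.
Proof.
move=> s0 st tl; rewrite /num21; apply/andP; split.
  by rewrite mulr_ge0 ?sqr_ge0.
rewrite -subr_gt0.
have -> : (1 - 2 * t) ^+ 2 * t - (1 - 2 * s) ^+ 2 * s =
  (t - s) * (1 - 4 * (t + s) + 4 * (t ^+ 2 + t * s + s ^+ 2)) by ring.
apply: mulr_gt0; first lra.
suff : 0 <= t ^+ 2 + t * s + s ^+ 2 by lra.
by rewrite !addr_ge0 ?sqr_ge0 ?mulr_ge0 //; lra.
Qed.

Lemma den21_le s t : 0 <= s -> s < t -> t <= 42 / 1000 ->
  0 < den21 t <= den21 s.
Proof.
move=> s0 st tl; rewrite /den21.
have h : 2 * (1 - 2 * t) ^+ 2 - 1 <= 2 * (1 - 2 * s) ^+ 2 - 1 by nra.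
have p : 0 < 2 * (1 - 2 * t) ^+ 2 - 1 by nra.
apply/andP; split; first by apply: mulr_gt0 => //; lra.
by apply: ler_pM => //; lra.
Qed.

Lemma num23_lt s t : 0 <= s -> s < t -> t <= 42 / 1000 ->
  0 <= num23 s < num23 t.
Proof.
move=> s0 st tl; rewrite /num23.
have t0 : 0 <= t by lra.
set X2 := t ^+ 2 + t * s + s ^+ 2.
set X4 := t ^+ 4 + t ^+ 3 * s + t ^+ 2 * s ^+ 2 + t * s ^+ 3 + s ^+ 4.
have h0 (k l : nat) : 0 <= t ^+ k * s ^+ l by rewrite mulr_ge0 ?exprn_ge0.
have X2_ge0 : 0 <= X2.
  by rewrite /X2; move: (h0 2 0) (h0 1 1) (h0 0 2); rewrite !expr0 !expr1; lra.
have X4_ge0 : 0 <= X4.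
  rewrite /X4; move: (h0 4 0) (h0 3 1) (h0 2 2) (h0 1 3) (h0 0 4).
  by rewrite !expr0 !expr1; lra.
have X6_ge0 : 0 <= t ^+ 6 + t * s * X4 + s ^+ 6.
  by rewrite !addr_ge0 ?exprn_ge0 // ?mulr_ge0 // ?mulr_ge0.
have tX2 : t ^+ 3 <= t * X2.
  rewrite /X2 -subr_ge0; move: (h0 2 1) (h0 1 2); rewrite !expr1; nra.
have tX4 : t ^+ 5 <= t * X4.
  rewrite exprS ler_wpM2l // /X4.
  by move: (h0 3 1) (h0 2 2) (h0 1 3) (h0 0 4); rewrite !expr0 !expr1; lra.
apply/andP; split.
  apply: mulr_ge0 => //.
  have e0 (k : nat) : 0 <= s ^+ k by rewrite exprn_ge0.
  have e1 (k : nat) : s ^+ k.+1 <= 42 / 1000 * s ^+ k.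
    by rewrite exprS; apply: ler_wpM2r => //; lra.
  move: (e0 2) (e1 2) (e0 4) (e1 4) (e0 6); lra.
(* Divided differences of the powers of t; the negative groups of degrees 3
   and 5 are absorbed by the positive ones of degrees 2 and 4. *)
rewrite -subr_gt0.
set lhs := (X in 0 < X).
have -> : lhs = (t - s) * (5 - 52 * (t + s)
   + (174 * X2 - 288 * (t ^+ 3 + s * X2)) + (272 * X4 - 144 * (t ^+ 5 + s * X4))
   + 32 * (t ^+ 6 + t * s * X4 + s ^+ 6)).
  by rewrite /lhs /X2 /X4; ring.
apply: mulr_gt0; first lra.
have : t * X2 <= 42 / 1000 * X2 by apply: ler_wpM2r.
have : s * X2 <= 42 / 1000 * X2 by apply: ler_wpM2r => //; lra.
have : t * X4 <= 42 / 1000 * X4 by apply: ler_wpM2r.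
have : s * X4 <= 42 / 1000 * X4 by apply: ler_wpM2r => //; lra.
lra.
Qed.

Lemma den23_le s t : 0 <= s -> s < t -> t <= 42 / 1000 ->
  0 < den23 t <= den23 s.
Proof.
move=> s0 st tl; rewrite /den23.
have E (x : R) : (24 * x ^+ 3 - 36 * x ^+ 2 + 18 * x - 1) * (-1 + x) ^+ 3
  * (8 * x ^+ 2 - 8 * x + 1) =
  (1 - 18 * x + 36 * x ^+ 2 - 24 * x ^+ 3) * (1 - x) ^+ 3 *
  (1 - 8 * x + 8 * x ^+ 2) by ring.
rewrite !E.
have a0 : 0 < 1 - 18 * t + 36 * t ^+ 2 - 24 * t ^+ 3 by nra.
have c0 : 0 < 1 - 8 * t + 8 * t ^+ 2 by nra.
have b0 : 0 < (1 - t) ^+ 3 by apply: exprn_gt0; lra.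
apply/andP; split; first exact: mulr_gt0 (mulr_gt0 a0 b0) c0.
apply: ler_pM; [exact: ltW (mulr_gt0 a0 b0) | exact: ltW | | nra].
apply: ler_pM; [exact: ltW | exact: ltW | |].
  rewrite -subr_ge0.
  have -> : 1 - 18 * s + 36 * s ^+ 2 - 24 * s ^+ 3
     - (1 - 18 * t + 36 * t ^+ 2 - 24 * t ^+ 3) =
    (t - s) * (18 - 36 * (t + s) + 24 * (t ^+ 2 + t * s + s ^+ 2)) by ring.
  apply: mulr_ge0; first lra.
  suff : 0 <= t ^+ 2 + t * s + s ^+ 2 by lra.
  by rewrite !addr_ge0 ?sqr_ge0 ?mulr_ge0 //; lra.
by rewrite lerXn2r ?nnegrE //; lra.
Qed.

Lemma ltr_pdiv (a a' d d' : R) :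
  0 <= a < a' -> 0 < d' <= d -> 0 <= a / d < a' / d'.
Proof.
move=> /andP[a0 aa'] /andP[d'0 dd']; have d0 : 0 < d by apply: lt_le_trans dd'.
rewrite divr_ge0 ?(ltW d0) //=.
apply: (@le_lt_trans _ _ (a / d')); last by rewrite ltr_pM2r ?invr_gt0.
by rewrite ler_wpM2l // lef_pV2 ?posrE.
Qed.

Lemma b21_b23_lt s t : 0 <= s -> s < t -> t <= 42 / 1000 ->
  2 * b21 s ^+ 2 + 2 * b23 s ^+ 2 < 2 * b21 t ^+ 2 + 2 * b23 t ^+ 2.
Proof.
move=> s0 st tl.
have /andP[p1 l1] := ltr_pdiv (num21_lt s0 st tl) (den21_le s0 st tl).
have /andP[p3 l3] := ltr_pdiv (num23_lt s0 st tl) (den23_le s0 st tl).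
rewrite -/(b21 s) -/(b21 t) in p1 l1; rewrite -/(b23 s) -/(b23 t) in p3 l3.
nra.
Qed.

(** The majorant equation with its denominators cleared, so that the
intermediate value theorem for polynomials applies. *)
Definition bgap c t : R := 2 * num21 t ^+ 2 * den23 t ^+ 2
  + 2 * num23 t ^+ 2 * den21 t ^+ 2 - c * (den21 t ^+ 2 * den23 t ^+ 2).

Lemma bgapE c t : 0 < t -> t <= 42 / 1000 ->
  (2 * b21 t ^+ 2 + 2 * b23 t ^+ 2 = c) <-> bgap c t = 0.
Proof.
move=> t0 tl.
have /andP[d1 _] := den21_le (lexx 0) t0 tl.
have /andP[d3 _] := den23_le (lexx 0) t0 tl.
have n1 : den21 t != 0 by rewrite gt_eqF.
have n3 : den23 t != 0 by rewrite gt_eqF.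
have -> : bgap c t = (2 * b21 t ^+ 2 + 2 * b23 t ^+ 2 - c)
                     * (den21 t ^+ 2 * den23 t ^+ 2).
  by rewrite /bgap /b21 /b23 -/(num21 t) -/(num23 t) -/(den21 t) -/(den23 t);
     field; rewrite n1 n3.
split=> [->|/eqP]; first by rewrite subrr mul0r.
rewrite mulf_eq0 subr_eq0 => /orP[/eqP //|].
by rewrite mulf_eq0 !expf_eq0 /= (negbTE n1) (negbTE n3).
Qed.

Lemma bgap_ivt c (a b : R) : a <= b -> bgap c a <= 0 -> 0 <= bgap c b ->
  exists2 x, a <= x <= b & bgap c x = 0.
Proof.
move=> ab ga gb.
have [p1 p1E] : exists p : {poly R}, forall x, p.[x] = num21 x.
  by exists ((1 - 2%:P * 'X) ^+ 2 * 'X) => x; rewrite /num21 !hornerE.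
have [q1 q1E] : exists q : {poly R}, forall x, q.[x] = den21 x.
  exists ((2%:P * (1 - 2%:P * 'X) ^+ 2 - 1) * (1 - 'X)) => x.
  by rewrite /den21 !hornerE.
have [p3 p3E] : exists p : {poly R}, forall x, p.[x] = num23 x.
  exists ('X * (32%:P * 'X ^+ 6 - 144%:P * 'X ^+ 5 + 272%:P * 'X ^+ 4
           - 288%:P * 'X ^+ 3 + 174%:P * 'X ^+ 2 - 52%:P * 'X + 5%:P)) => x.
  by rewrite /num23 !hornerE.
have [q3 q3E] : exists q : {poly R}, forall x, q.[x] = den23 x.
  exists ((24%:P * 'X ^+ 3 - 36%:P * 'X ^+ 2 + 18%:P * 'X - 1) * (-1 + 'X) ^+ 3
           * (8%:P * 'X ^+ 2 - 8%:P * 'X + 1)) => x.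
  by rewrite /den23 !hornerE.
pose q := 2%:P * p1 ^+ 2 * q3 ^+ 2 + 2%:P * p3 ^+ 2 * q1 ^+ 2
          - c%:P * (q1 ^+ 2 * q3 ^+ 2).
have qE x : q.[x] = bgap c x.
  rewrite /q /bgap !(hornerD, hornerN, hornerM, horner_exp, hornerC).
  by rewrite p1E q1E p3E q3E.
have [|x xab] := @poly_ivt R q a b ab; first by rewrite !qE ga gb.
by rewrite /root qE => /eqP qx; exists x.
Qed.

(** By strict monotonicity, a root below 42/1000 is the only one there, hence
the smallest. *)
Lemma smallest_root_exists c (a b : R) : 0 < a -> a <= b -> b <= 42 / 1000 ->
  bgap c a <= 0 -> 0 <= bgap c b ->
  exists2 x, a <= x <= b &
    smallest_positive (fun t => 2 * b21 t ^+ 2 + 2 * b23 t ^+ 2 = c) x.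
Proof.
move=> a0 ab b1 ga gb; have [x /andP[ax xb] gx] := bgap_ivt ab ga gb.
exists x; first by rewrite ax.
have x0 : 0 < x by apply: lt_le_trans ax.
have x1 : x <= 42 / 1000 by apply: le_trans b1.
have Fx := (bgapE c x0 x1).2 gx.
split=> // v v0 Fv; rewrite leNgt; apply/negP => vx.
by have := b21_b23_lt (ltW v0) vx x1; rewrite Fx Fv ltxx.
Qed.

Lemma root_one : exists2 x : R, 4175 / 10 ^+ 5 <= x <= 4185 / 10 ^+ 5 &
    smallest_positive (fun t => 2 * b21 t ^+ 2 + 2 * b23 t ^+ 2 = 1) x.
Proof.
apply: smallest_root_exists; try lra.
  by rewrite /bgap /num21 /num23 /den21 /den23; lra.
by rewrite /bgap /num21 /num23 /den21 /den23; lra.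
Qed.

Lemma root_quarter : exists2 x : R, 3175 / 10 ^+ 5 <= x <= 3185 / 10 ^+ 5 &
    smallest_positive (fun t => 2 * b21 t ^+ 2 + 2 * b23 t ^+ 2 = 4^-1) x.
Proof.
apply: smallest_root_exists; try lra.
  by rewrite /bgap /num21 /num23 /den21 /den23; lra.
by rewrite /bgap /num21 /num23 /den21 /den23; lra.
Qed.
End Roots.

(** * Iteration *)

Section Iteration.
Context {R : realType} {m : nat}.
Variables (f : polysystem R m) (xi : 'cV[R[i]]_m.+1).
Hypothesis hxi : simple_double_zero_normalized f xi.
Local Notation G := (gamma2 f xi).

Lemma newton_contracts z : G ^+ 2 * hnorm (z - xi) <= 42 / 1000 ->
  newton_defined f z /\
  hnorm (newton f z - xi) <= 7 * (G ^+ 2 * hnorm (z - xi) * hnorm (z - xi)).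
Proof. by move=> h; have := newton_contraction hxi h; rewrite subrKC. Qed.

(** If the error at y is q e with q = 2^-(2^k - 1), the next one is at most
7 G^2 (q e)^2 = 7 (G^2 e) q^2 e < 1/2 q^2 e, as 7 * 32/1000 < 1/2. *)
Lemma newton_quadratic z y k : G ^+ 2 * hnorm (z - xi) <= 32 / 1000 ->
  0 < hnorm (z - xi) ->
  hnorm (y - xi) <= 2^-1 ^+ (2 ^ k - 1) * hnorm (z - xi) ->
  newton_defined f y /\
  hnorm (newton f y - xi) < 2^-1 ^+ (2 ^ k.+1 - 1) * hnorm (z - xi).
Proof.
move=> us e0 hy; set e := hnorm (z - xi) in us e0 hy *.
set q := 2^-1 ^+ (2 ^ k - 1) in hy.
have q0 : 0 < q by rewrite exprn_gt0 // invr_gt0.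
have q1 : q <= 1 by rewrite exprn_ile1 // ?invr_ge0 // invf_le1 // ler1n.
have G2 : 0 <= G ^+ 2 by rewrite sqr_ge0.
have y0 := hnorm_ge0 (y - xi).
have ye : hnorm (y - xi) <= e.
  by rewrite (le_trans hy) // -[leRHS]mul1r ler_wpM2r // ltW.
have [|def_y le_y] := @newton_contracts y.
  have : G ^+ 2 * hnorm (y - xi) <= G ^+ 2 * e by rewrite ler_wpM2l.
  lra.
split=> //; apply: le_lt_trans le_y _.
have -> : 2^-1 ^+ (2 ^ k.+1 - 1) = 2^-1 * (q * q) :> R.
  have k0 : (0 < 2 ^ k)%N by rewrite expn_gt0.
  by rewrite /q -exprD -exprS; congr (_ ^+ _); rewrite expnS; lia.
have hyy : hnorm (y - xi) * hnorm (y - xi) <= (q * e) * (q * e).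
  by rewrite ler_pM.
have : G ^+ 2 * (hnorm (y - xi) * hnorm (y - xi)) <= G ^+ 2 * ((q * e) * (q * e)).
  by rewrite ler_wpM2l.
have -> : G ^+ 2 * ((q * e) * (q * e)) = (G ^+ 2 * e) * (q * q * e) by ring.
have qqe : 0 < q * q * e by rewrite !mulr_gt0.
have : (G ^+ 2 * e) * (q * q * e) <= 32 / 1000 * (q * q * e).
  by rewrite ler_wpM2r // ltW.
lra.
Qed.

Lemma newton_iter_le z k : G ^+ 2 * hnorm (z - xi) <= 32 / 1000 ->
  0 < hnorm (z - xi) ->
  hnorm (iter k (newton f) z - xi) <= 2^-1 ^+ (2 ^ k - 1) * hnorm (z - xi).
Proof.
move=> us e0; elim: k => [|k IH]; first by rewrite mul1r.
by have [_ /ltW] := newton_quadratic us e0 IH.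
Qed.
End Iteration.

Theorem theorem9 (R : realType) (m : nat) (hm : (2 <= m.+1)%N)
    (f : polysystem R m) (xi z : 'cV[R[i]]_m.+1)
    (hxi : simple_double_zero_normalized f xi) (hz : z <> xi) :
  let u : R := gamma2 f xi ^+ 2 * hnorm (z - xi) in
  (exists u2 : R,
    [/\ smallest_positive
          (fun t => 2 * b21 t ^+ 2 + 2 * b23 t ^+ 2 = 1) u2,
        approx4 u2 (418 / 10 ^+ 4)
      & u < u2 ->
        newton_defined f z /\
        hnorm (newton f z - xi) < hnorm (z - xi)]) /\
  (exists u2' : R,
    [/\ smallest_positive
          (fun t => 2 * b21 t ^+ 2 + 2 * b23 t ^+ 2 = 4^-1) u2',
        approx4 u2' (318 / 10 ^+ 4)
      & u < u2' ->
        forall k : nat, (1 <= k)%N ->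
          (forall j : nat, (j < k)%N ->
             newton_defined f (iter j (newton f) z)) /\
          hnorm (iter k (newton f) z - xi)
            < (2^-1) ^+ (2 ^ k - 1) * hnorm (z - xi)]).
Proof.
move=> u.
have e0 : 0 < hnorm (z - xi).
  by rewrite lt_def hnorm_ge0 hnorm_eq0 subr_eq0 andbT; apply/eqP.
split.
  have [v /andP[v1 v2] v_root] := root_one (R := R).
  exists v; split=> //; first by rewrite /approx4 ler_norml; lra.
  move=> uv; have us : u <= 42 / 1000 by lra.
  have [def_z le_z] := newton_contracts hxi us; split=> //.
  apply: le_lt_trans le_z _; rewrite -/u.
  have : u * hnorm (z - xi) <= 42 / 1000 * hnorm (z - xi) by rewrite ler_wpM2r // ltW.
  lra.
have [v /andP[v1 v2] v_root] := root_quarter (R := R).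
exists v; split=> //; first by rewrite /approx4 ler_norml; lra.
move=> uv k k1; have us : u <= 32 / 1000 by lra.
have step j := newton_quadratic hxi us e0 (newton_iter_le hxi j us e0).
split=> [j _|]; first by have [] := step j.
by case: k k1 => // k _; have [] := step k.
Qed.
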